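(* Let $(H,\mathbf{x})$, with $H=H(t)\in\mathbb{R}$ and $\mathbf{x}=\mathbf{x}(t)\in\mathbb{R}^n$, $t\ge 0$, be a solution of the system $$\dot H(t)=H(t)^2 f^{[2]}(\mathbf{x}(t),t),\qquad \dot{\mathbf{x}}(t)=H(t)\,\mathbf{f}^1(\mathbf{x}(t),t),$$ with initial condition $\mathbf{x}(0)=\mathbf{x}_0$. Suppose that $H(t)>0$ is strictly decreasing in $t$ and that $\lim_{t\to\infty}H(t)=0$. Fix any $\varepsilon>0$ with $\varepsilon<H(0)$ and define $t_*>0$ by $\varepsilon=H(t_* )$. Suppose that $$\|\mathbf{f}^1\|_{L^\infty_{\mathbf{x},t}}<\infty,\qquad \|f^{[2]}\|_{L^\infty_{\mathbf{x},t}}<\infty,$$ and that $\mathbf{f}^1(\mathbf{x},t)$ is Lipschitz continuous and $f^{[2]}(\mathbf{x},t)$ is continuous with respect to $\mathbf{x}$ for all $t\ge t_*$. Assume also that $\mathbf{f}^1$ and $f^{[2]}$ are $T$-periodic in $t$ for some $T>0$. Let $\mathbf{z}(t)$ be the solution of the averaged equation $$\dot{\mathbf{z}}=H(t_* )\,\bar{\mathbf{f}}^1(\mathbf{z})\quad\text{for } t>t_*,\qquad \mathbf{z}(t_* )=\mathbf{x}(t_* ),$$ where $$\bar{\mathbf{f}}^1(\mathbf{z})=\frac1T\int_{t_*}^{t_*+T}\mathbf{f}^1(\mathbf{z},s)\,ds .$$ Then, for any given $\gamma\in(0,1)$ and for all $t>t_*$ with $t=t_*+O(H(t_* )^{-\gamma})$,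 we have $$\mathbf{x}(t)-\mathbf{z}(t)=O\big(H(t_* )^{\min\{1,\,2-2\gamma\}}\big).$$
   Context: Here $\mathbf{f}^1:\mathbb{R}^n\times[0,\infty)\to\mathbb{R}^n$ and $f^{[2]}:\mathbb{R}^n\times[0,\infty)\to\mathbb{R}$ are given functions of $(\mathbf{x},t)$; the superscripts $1$ and $[2]$ are labels, not powers. A dot denotes $d/dt$. The norm on $\mathbb{R}^n$ is $\|\mathbf{u}\|=\sum_{i=1}^n|u_i|$, and $\|f\|_{L^\infty_{\mathbf{x},t}}=\sup_{\mathbf{x},t}|f(\mathbf{x},t)|$ (with $|\cdot|$ replaced by $\|\cdot\|$ for vector-valued functions). ''Lipschitz continuous with respect to $\mathbf{x}$ for all $t\ge t_*$'' means that there is a constant $c_L$ with $\|\mathbf{f}^1(\mathbf{x},t)-\mathbf{f}^1(\mathbf{y},t)\|\le c_L\|\mathbf{x}-\mathbf{y}\|$ for all $\mathbf{x},\mathbf{y}\in\mathbb{R}^n$ and all $t\ge t_*$. Meaning of the $O$-notation: for every $C>0$ there is a constant $K>0$ such that $\|\mathbf{x}(t)-\mathbf{z}(t)\|\le K\,H(t_* )^{\min\{1,2-2\gamma\}}$ for all $t$ with $t_*<t\le t_*+C\,H(t_* )^{-\gamma}$. The constant $K$ may depend on $C$, $\gamma$, $n$, $T$, $H(0)$, $c_L$, $\|\mathbf{f}^1\|_{L^\infty_{\mathbf{x},t}}$ and $\|f^{[2]}\|_{L^\infty_{\mathbf{x},t}}$, but not otherwise on $t_*$ (equivalently $\varepsilon$)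 or on $t$. *)

(* Defs.v *)
From mathcomp Require Import all_boot all_order all_algebra.
From mathcomp Require Import all_classical all_reals all_analysis.
Import Order.TTheory GRing.Theory Num.Theory.
Import numFieldNormedType.Exports.
Set Implicit Arguments.
Unset Strict Implicit.
Unset Printing Implicit Defensive.
Local Open Scope classical_set_scope.
Local Open Scope ring_scope.

(* The library norm `|u| on 'rV[R]_n is the max norm, not this one. *)
Definition l1norm (R : realType) (n : nat) (u : 'rV[R]_n) : R :=
  \sum_(i < n) `|u 0 i|.

(* Time-dependent fields are total in t; only their values for 0 <= t count. *)
Definition Linfty_norm (R : realType) (n m : nat)
    (g : 'rV[R]_n -> R -> 'rV[R]_m) : \bar R :=
  ereal_sup [set (l1norm (g p.1 p.2))%:E | p in [set p | 0 <= p.2]].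

Definition Linfty_norm_scalar (R : realType) (n : nat)
    (g : 'rV[R]_n -> R -> R) : \bar R :=
  ereal_sup [set `|g p.1 p.2|%:E | p in [set p | 0 <= p.2]].

Definition periodic_in_time (R : realType) (n : nat) (V : Type) (T : R)
    (g : 'rV[R]_n -> R -> V) : Prop :=
  forall v t, 0 <= t -> g v (t + T) = g v t.

(* Two-sided derivative at t > 0, right derivative at t = 0. *)
Definition has_deriv_on_nonneg (R : realType) (V : normedModType R)
    (y : R -> V) (t : R) (v : V) : Prop :=
  (s - t)^-1 *: (y s - y t) @[s --> within `[0, +oo[ t^'] --> v.

Definition time_average (R : realType) (n : nat)
    (f : 'rV[R]_n -> R -> 'rV[R]_n) (t T : R) (v : 'rV[R]_n) : 'rV[R]_n :=
  \row_i (T^-1 * \int[lebesgue_measure]_(s in `[t, t + T]) f v s 0 i).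

(* Main.v *)
(* Put e = H ts. On a horizon of length l after ts, H differs from e by O(e^2 l).
   On one period, x moves by e T (the average of f1 at the current state) up to
   O(e^2 T (T + l)), because x itself moves by O(e T) while H drifts by
   O(e^2 l); the averaged solution z satisfies the same one-step relation.
   A discrete Gronwall inequality over the l / T periods bounds the distance by
   O(e^2 l^2 + e^2 l) exp(O(e l)), and the incomplete last period adds O(e).
   With l = C e^(-gamma) and gamma < 1 the exponential stays bounded and what
   remains is O(e^min(1, 2 - 2 gamma)). *)
Require Import Defs.
From mathcomp Require Import all_boot all_order all_algebra.
From mathcomp Require Import all_classical all_reals all_analysis.
From mathcomp Require Import measurable_realfun ring lra.
Import Order.TTheory GRing.Theory Num.Theory.
Import numFieldNormedType.Exports.
Local Open Scope classical_set_scope.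
Local Open Scope ring_scope.

Set Implicit Arguments.
Unset Strict Implicit.
Unset Printing Implicit Defensive.

(** * Real calculus: derivatives, mean value bounds and integrals of bounded derivatives *)

Section calculus.
Context {R : realType}.
Implicit Types (f df : R -> R) (a b c d s t M : R).

Lemma is_derive1_cvg (V : normedModType R) (y : R -> V) t v :
  is_derive t 1 y v <-> (h^-1 *: (y (t + h) - y t)) @[h --> 0^'] --> v.
Proof.
have E : (fun h : R => h^-1 *: ((y \o shift t) (h *: (1 : R)) - y t)) =
         (fun h => h^-1 *: (y (t + h) - y t)).
  by apply/funext => h /=; rewrite [h *: 1]mulr1 (addrC h).
split=> [[dy <-]|yv]; first by rewrite -E.
split; first by rewrite /derivable E; exact: (cvgP v yv).
rewrite /derive E; exact: (cvg_lim (@norm_hausdorff _ _) yv).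
Qed.

Lemma has_deriv_on_nonneg_is_derive (V : normedModType R) (y : R -> V) t v :
  0 < t -> has_deriv_on_nonneg y t v -> is_derive t 1 y v.
Proof.
move=> t0 /cvgrPdist_le yv; apply/is_derive1_cvg/cvgrPdist_le => e e0.
have := yv e e0; rewrite !near_withinE => /nbhs_ballP[d /= d0 dP].
(* A radius at most [t] keeps [t + h] nonnegative, so near [t] the restriction to [[0, +oo[] has no
   effect. *)
apply/nbhs_ballP; exists (Num.min d t) => /=; first by rewrite lt_min d0.
move=> h; rewrite /ball/= sub0r normrN lt_min => /andP[hd ht] h0.
have := dP (t + h); rewrite /ball/= opprD addNKr normrN hd addrAC subrr add0r.
apply => //; first by rewrite -subr_eq0 addrAC subrr add0r.
move: ht; rewrite in_itv/= andbT ltr_norml => /andP[+ _]; lra.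
Qed.

Lemma is_derive1_continuous f t d : is_derive t 1 f d -> {for t, continuous f}.
Proof. by move=> [df _]; exact/differentiable_continuous/derivable1_diffP. Qed.

Lemma is_derive1_shift f t k d :
  is_derive (t + k) 1 f d -> is_derive t 1 (fun s => f (s + k)) d.
Proof.
move=> dF; rewrite -[d]mulr1.
exact: (@is_derive1_comp _ f (shift k) t d 1 dF (is_derive_shift t 1 k)).
Qed.

Lemma is_derive_coord m n (M : R -> 'M[R]_(m, n)) t D i j :
  is_derive t 1 M D -> is_derive t 1 (fun s => M s i j) (D i j).
Proof.
move=> [dM <-]; split; first by move/derivable_mxP : dM.
by rewrite derive_mx// mxE.
Qed.

(** Differentiability is asked for only inside the interval, so that the bound applies to [z] from
    [ts] on, where [z] is known to be right continuous only. *)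
Lemma MVT_le f df a b M : a <= b ->
  (forall s, s \in `]a, b[%R -> is_derive s 1 f (df s)) ->
  {within `[a, b], continuous f} ->
  (forall s, s \in `]a, b[%R -> `|df s| <= M) ->
  `|f b - f a| <= M * (b - a).
Proof.
move=> + dF cf dM; rewrite le_eqVlt => /predU1P[->|ab].
  by rewrite !subrr mulr0 normr0.
have [c cab ->] := MVT ab dF cf.
rewrite normrM (gtr0_norm (_ : 0 < b - a)) ?subr_gt0//.
by rewrite ler_wpM2r ?dM// subr_ge0 ltW.
Qed.

(** The step runs through the sequence 1/(k+1), the form in which dominated convergence will use the
    quotients. *)
Lemma cvg_diff_quotient f t d : is_derive t 1 f d ->
  (k.+1%:R * (f (t + k.+1%:R^-1) - f t)) @[k --> \oo] --> d.
Proof.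
move=> /is_derive1_cvg fd.
have h0 : (forall k, @harmonic R k != 0) /\ @harmonic R @ \oo --> 0.
  by split=> [k|]; [rewrite gt_eqF ?harmonic_gt0|exact: cvg_harmonic].
suff E : (fun k => k.+1%:R * (f (t + k.+1%:R^-1) - f t)) =
    (fun k => (harmonic k)^-1 *: (f (t + harmonic k) - f t)).
  by rewrite E; exact: ((cvgr_dnbhsP _ _ _).1 fd _ h0).
by apply/funext => k; rewrite /harmonic/= invrK.
Qed.

Lemma is_derive1_within_continuous f df a b c : c < a ->
  (forall s, c < s -> is_derive s 1 f (df s)) ->
  {within `[a, b], continuous f}.
Proof.
move=> ca dF; apply: derivable_within_continuous => s /itvP s_ab.
by apply: (@ex_derive _ _ _ _ _ _ _ (dF s _)); rewrite (lt_le_trans ca) ?s_ab.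
Qed.

(** The integral starts at [c], strictly beyond [a], so that [f] is continuous on the closed
    intervals of integration. *)
Lemma ex_antiderivative f a : (forall s, a < s -> {for s, continuous f}) ->
  forall c, a < c -> exists F : R -> R, forall s, c < s -> is_derive s 1 F (f s).
Proof.
move=> cf c ac; exists (fun u => \int[lebesgue_measure]_(t in `[c, u]) f t).
move=> s cs; have ss1 : s < s + 1 by rewrite ltrDl.
have fi : lebesgue_measure.-integrable `[c, s + 1] (EFin \o f).
  apply: continuous_compact_integrable; first exact: segment_compact.
  apply: continuous_in_subspaceT => u; rewrite inE/= => /itvP u_c.
  by apply: cf; rewrite (lt_le_trans ac) ?u_c.
have [dF FE] := continuous_FTC1_closed ss1 fi cs (cf s (lt_trans ac cs)).
by split; [exact: dF|rewrite -derive1E; exact: FE].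
Qed.

(* The derivative need not be continuous. The difference quotients of [f] with
   step 1/(k+1) are themselves derivatives of difference quotients of an
   antiderivative of [f], so their integrals are explicit and converge to
   [f b - f a]; dominated convergence identifies the limit. *)
Lemma bounded_derivative_FTC f df a b c M : c < a -> a < b ->
  (forall s, c < s -> is_derive s 1 f (df s)) ->
  (forall s, c < s -> `|df s| <= M) ->
  lebesgue_measure.-integrable `[a, b] (EFin \o df) /\
  \int[lebesgue_measure]_(s in `[a, b]) df s = f b - f a.
Proof.
(* The antiderivative [F] of [f] will be differentiable only to the right of [d]; the midpoint
   leaves room for a two-sided derivative at [a]. *)
move=> ca ab dF dM; pose d := (c + a) / 2.
have [cd da] : c < d /\ d < a by rewrite /d; split; lra.
have cf s : c < s -> {for s, continuous f}.
  by move=> /dF; exact: is_derive1_continuous.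
have [F dFf] := @ex_antiderivative f c cf d cd.
pose q (F : R -> R) k s := k.+1%:R * (F (s + k.+1%:R^-1) - F s).
have h0 k : 0 < (k.+1%:R^-1 : R) by rewrite invr_gt0 ltr0n.
have dq (g dg : R -> R) e : (forall s, e < s -> is_derive s 1 g (dg s)) ->
    forall k s, e < s -> is_derive s 1 (q g k) (q dg k s).
  move=> dg' k s es; rewrite /q.
  have : is_derive s 1 (fun s => g (s + k.+1%:R^-1) - g s)
      (dg (s + k.+1%:R^-1) - dg s).
    apply: is_deriveB; last exact: dg'.
    by apply: is_derive1_shift; apply: dg'; rewrite (lt_trans es)// ltrDl.
  by move=> /(@is_deriveZ _ _ _ _ (k.+1%:R : R)).
have cq k : {within `[a, b], continuous (q f k)}.
  exact: is_derive1_within_continuous ca (dq _ _ _ dF k).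
have intq k : (\int[lebesgue_measure]_(s in `[a, b]) (q f k s)%:E =
    (q F k b - q F k a)%:E)%E.
  rewrite (@continuous_FTC2 _ _ (q F k)) ?EFinB//.
    split.
    - move=> s /itvP s_ab; apply: (@ex_derive _ _ _ _ _ _ _ (dq _ _ _ dFf k s _)).
      by rewrite (lt_trans da) ?s_ab.
    - exact/cvg_at_right_filter/(@is_derive1_continuous _ _ _ (dq _ _ _ dFf k a da)).
    - exact/cvg_at_left_filter/(@is_derive1_continuous _ _ _
        (dq _ _ _ dFf k b (lt_trans da ab))).
  move=> s /itvP s_ab; rewrite derive1E.
  apply: (@derive_val _ _ _ _ _ _ _ (dq _ _ _ dFf k s _)).
  by rewrite (lt_trans da) ?s_ab.
have limq : (q F k b - q F k a)%:E @[k --> \oo] --> (f b - f a)%:E.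
  apply: cvg_EFin; first exact: nearW.
  apply: cvgB; apply: cvg_diff_quotient; apply: dFf => //; exact: lt_trans ab.
have mq k : measurable_fun `[a, b] (EFin \o q f k).
  apply/measurable_EFinP; apply: subspace_continuous_measurable_fun => //.
  exact: cq.
have qdf : {ae lebesgue_measure, forall s, `[a, b]%classic s ->
    (q f k s)%:E @[k --> \oo] --> (df s)%:E}.
  apply: aeW => s /itvP s_ab; apply: cvg_EFin; first exact: nearW.
  by apply: cvg_diff_quotient; apply: dF; rewrite (lt_le_trans ca) ?s_ab.
(* The mean value bound on a step of length 1/(k+1) makes the constant [M] a dominating function for
   all the quotients. *)
have qM : {ae lebesgue_measure, forall s k, `[a, b]%classic s ->
    (`|(q f k s)%:E| <= (cst M%:E : R -> \bar R) s)%E}.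
  apply: aeW => s k /itvP s_ab; rewrite /= lee_fin.
  have cs : c < s by rewrite (lt_le_trans ca) ?s_ab.
  rewrite /q normrM ger0_norm// -ler_pdivlMl// mulrC.
  have -> : (k.+1%:R^-1 : R) = s + k.+1%:R^-1 - s by rewrite addrAC subrr add0r.
  rewrite [in leLHS]addrCA subrr addr0.
  apply: (@MVT_le _ df).
  - by rewrite lerDl ltW.
  - by move=> u /itvP u_s; apply: dF; rewrite (lt_trans cs) ?u_s.
  - exact: is_derive1_within_continuous cs dF.
  - by move=> u /itvP u_s; apply: dM; rewrite (lt_trans cs) ?u_s.
(* [df] is measurable as a pointwise limit of the continuous quotients [q f k]. *)
have mdf : measurable_fun `[a, b] (EFin \o df).
  apply: (emeasurable_fun_cvg _ _ mq) => s /itvP s_ab.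
  apply: cvg_EFin; first exact: nearW.
  by apply: cvg_diff_quotient; apply: dF; rewrite (lt_le_trans ca) ?s_ab.
have iM : lebesgue_measure.-integrable `[a, b] (cst M%:E : R -> \bar R).
  apply: (@continuous_compact_integrable R (cst M)); first exact: segment_compact.
  by apply: continuous_subspaceT => s; exact: cst_continuous.
have [//|idf _ dfl] := @dominated_convergence _ _ _ lebesgue_measure `[a, b] _
  (fun k => EFin \o q f k) (EFin \o df) (cst M%:E) mq mdf qdf iM qM.
split => //; rewrite /Rintegral.
suff -> : (\int[lebesgue_measure]_(s in `[a, b]) (df s)%:E =
   (f b - f a)%:E)%E by [].
apply: cvg_unique dfl _ => //.
suff -> : (fun k => \int[lebesgue_measure]_(s in `[a, b]) (q f k s)%:E)%E =
  (fun k => (q F k b - q F k a)%:E) by [].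
by apply/funext => k; exact: intq.
Qed.
End calculus.

(** * Bounds for integrals over a compact interval *)

Section interval_integral.
Context {R : realType}.
Notation mu := (@lebesgue_measure R).
Implicit Types (g h f df : R -> R) (a b c d M : R).

Lemma Rintegral_itv_bound g a b M : a <= b ->
  mu.-integrable `[a, b] (EFin \o g) ->
  (forall s, s \in `[a, b]%R -> `|g s| <= M) ->
  `|\int[mu]_(s in `[a, b]) g s| <= M * (b - a).
Proof.
move=> ab ig gM; apply: le_trans (le_normr_Rintegral _ ig) _ => //.
have -> : M * (b - a) = \int[mu]_(s in `[a, b]) M.
  rewrite Rintegral_cst//= lebesgue_measure_itv/= lte_fin.
  by case: ltP => [//|ba]; rewrite (@le_anti _ _ a b) ?ab// subrr.
apply: le_Rintegral => //; first exact: (integrable_norm ig).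
apply: (@continuous_compact_integrable R (cst M)); first exact: segment_compact.
by apply: continuous_subspaceT => s; exact: cst_continuous.
Qed.

Lemma Rintegral_itv_dist g h a b d : a <= b ->
  mu.-integrable `[a, b] (EFin \o g) -> mu.-integrable `[a, b] (EFin \o h) ->
  (forall s, s \in `[a, b]%R -> `|g s - h s| <= d) ->
  `|\int[mu]_(s in `[a, b]) g s - \int[mu]_(s in `[a, b]) h s| <= d * (b - a).
Proof.
move=> ab ig ih gh; rewrite -RintegralB//.
apply: Rintegral_itv_bound => //; exact: (integrableB _ ig ih).
Qed.

(** Serves to replace the velocity over a period by the one with the state and [H] frozen. Only
    boundedness of [df] is asked for, because the field is not assumed continuous in time. *)
Lemma derivative_near_integral f df g a b c d M : c < a -> a < b ->
  (forall s, c < s -> is_derive s 1 f (df s)) ->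
  (forall s, c < s -> `|df s| <= M) ->
  mu.-integrable `[a, b] (EFin \o g) ->
  (forall s, s \in `[a, b]%R -> `|df s - g s| <= d) ->
  `|f b - f a - \int[mu]_(s in `[a, b]) g s| <= d * (b - a).
Proof.
move=> ca ab dF dM ig dfg.
have [idf <-] := bounded_derivative_FTC ca ab dF dM.
by apply: Rintegral_itv_dist => //; exact: ltW.
Qed.

End interval_integral.

(** * The sum norm and its coordinates *)

Section l1norm.
Context {R : realType} {n : nat}.
Implicit Types u v : 'rV[R]_n.

Lemma l1norm_ge0 u : 0 <= l1norm u.
Proof. exact: sumr_ge0. Qed.

Lemma coord_le_l1norm u i : `|u 0 i| <= l1norm u.
Proof. by rewrite /l1norm (bigD1 i)//= lerDl sumr_ge0. Qed.

(** Estimates below are made coordinate by coordinate; returning to the norm costs a factor [n]. *)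
Lemma l1norm_le u d : (forall i, `|u 0 i| <= d) -> l1norm u <= n%:R * d.
Proof.
move=> ud; rewrite /l1norm mulr_natl.
by apply: le_trans (ler_sum _ (fun i _ => ud i)) _; rewrite sumr_const card_ord.
Qed.

End l1norm.

(** * Bounds inherited by the time average *)

Section time_average.
Context {R : realType} {n : nat}.
Variables (f : 'rV[R]_n -> R -> 'rV[R]_n) (t T : R).
Hypothesis T_gt0 : 0 < T.
Hypothesis f_int : forall v i, lebesgue_measure.-integrable `[t, t + T]
  (fun s => (f v s 0 i)%:E).

Lemma time_average_bound v i M :
  (forall s, s \in `[t, t + T]%R -> `|f v s 0 i| <= M) ->
  `|time_average f t T v 0 i| <= M.
Proof.
move=> fM; rewrite mxE normrM gtr0_norm ?invr_gt0// ler_pdivrMl// mulrC.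
have := @Rintegral_itv_bound _ (fun s => f v s 0 i) t (t + T) M.
rewrite [t + T - t]addrAC subrr add0r; apply => //; first by rewrite lerDl ltW.
exact: f_int.
Qed.

Lemma time_average_dist u v i d :
  (forall s, s \in `[t, t + T]%R -> `|f u s 0 i - f v s 0 i| <= d) ->
  `|time_average f t T u 0 i - time_average f t T v 0 i| <= d.
Proof.
move=> fd; rewrite !mxE -mulrBr normrM gtr0_norm ?invr_gt0// ler_pdivrMl// mulrC.
have := @Rintegral_itv_dist _ (fun s => f u s 0 i) (fun s => f v s 0 i) t (t + T) d.
rewrite [t + T - t]addrAC subrr add0r; apply => //; first by rewrite lerDl ltW.
- exact: f_int.
- exact: f_int.
Qed.

End time_average.

(** * Iterated periodicity and a discrete Gronwall inequality *)

Lemma periodic_in_time_mulrn (R : realType) (n : nat) (V : Type) (T : R)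
    (g : 'rV[R]_n -> R -> V) v t k : 0 <= T -> periodic_in_time T g ->
  0 <= t -> g v (t + k%:R * T) = g v t.
Proof.
move=> T0 gT t0; elim: k => [|k IHk]; first by rewrite mul0r addr0.
by rewrite -natr1 mulrDl mul1r addrA gT// addr_ge0// mulr_ge0.
Qed.

(** The geometric sum with ratio [q] is replaced by its cruder bound [N * q ^+ N], which needs no
    division by [q - 1] and so covers [q = 1]. *)
Lemma discrete_gronwall (R : realFieldType) (d : nat -> R) q r N :
  1 <= q -> 0 <= r -> d 0%N <= 0 ->
  (forall k, (k < N)%N -> d k.+1 <= q * d k + r) ->
  d N <= N%:R * r * q ^+ N.
Proof.
move=> q1 r0 d0; elim: N => [_|N IHN dS]; first by rewrite !mul0r.
have {}IHN : d N <= N%:R * r * q ^+ N by apply: IHN => k /ltnW; exact: dS.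
apply: le_trans (dS N (ltnSn N)) _.
rewrite -natr1 !mulrDl mul1r lerD//.
  by rewrite exprS mulrCA ler_wpM2l// (le_trans _ q1).
by rewrite ler_peMr// exprn_ege1.
Qed.

(** * A priori bounds on [H], [x] and [z] after [ts] *)

Section averaging.
Context {R : realType} {n : nat}.
Variables (f1 : 'rV[R]_n -> R -> 'rV[R]_n) (f2 : 'rV[R]_n -> R -> R).
Variables (H : R -> R) (x z : R -> 'rV[R]_n) (ts T L M1 M2 : R).
Hypothesis T_gt0 : 0 < T.
Hypothesis ts_gt0 : 0 < ts.
Hypothesis L_ge0 : 0 <= L.
Hypothesis M1_ge0 : 0 <= M1.
Hypothesis M2_ge0 : 0 <= M2.
Hypothesis dH : forall t : R, 0 < t -> is_derive t 1 H (H t ^+ 2 * f2 (x t) t).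
Hypothesis dx : forall t : R, 0 < t -> is_derive t 1 x (H t *: f1 (x t) t).
Hypothesis H_gt0 : forall t, 0 <= t -> 0 < H t.
Hypothesis H_le : forall s t, 0 <= s -> s <= t -> H t <= H s.
Hypothesis f1_bound : forall v t i, 0 <= t -> `|f1 v t 0 i| <= M1.
Hypothesis f2_bound : forall v t, 0 <= t -> `|f2 v t| <= M2.
Hypothesis f1_lip : forall u v t i, ts <= t ->
  `|f1 u t 0 i - f1 v t 0 i| <= L * l1norm (u - v).
Hypothesis f1_periodic : periodic_in_time T f1.
Hypothesis f1_int : forall v i, lebesgue_measure.-integrable `[ts, ts + T]
  (fun s => (f1 v s 0 i)%:E).
Hypothesis z_right_cont : z s @[s --> ts^'+] --> z ts.
Hypothesis dz : forall t : R, ts < t ->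
  is_derive t 1 z (H ts *: time_average f1 ts T (z t)).
Hypothesis z_ts : z ts = x ts.

Let e := H ts.
Let fbar := time_average f1 ts T.

Let e_ge0 : 0 <= e. Proof. by rewrite ltW// H_gt0// ltW. Qed.

Let itv_ge s : s \in `[ts, ts + T]%R -> ts <= s.
Proof. by rewrite in_itv => /andP[]. Qed.

Let itv_ge0 s : s \in `[ts, ts + T]%R -> 0 <= s.
Proof. by move=> /itv_ge; apply: le_trans; rewrite ltW. Qed.

Let dxi (t : R) i : 0 < t -> is_derive t 1 (fun s => x s 0 i) (H t * f1 (x t) t 0 i).
Proof. by move=> /dx/(@is_derive_coord _ _ _ _ _ _ 0 i); rewrite mxE. Qed.

Let dzi (t : R) i : ts < t -> is_derive t 1 (fun s => z s 0 i) (e * fbar (z t) 0 i).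
Proof. by move=> /dz/(@is_derive_coord _ _ _ _ _ _ 0 i); rewrite mxE. Qed.

Let H_abs_le t : ts <= t -> `|H t| <= e.
Proof.
move=> tst; rewrite ger0_norm; first by rewrite H_le// ltW.
by rewrite ltW// H_gt0// (le_trans _ tst)// ltW.
Qed.

(** Right continuity at [ts] is enough for continuity relative to an interval that starts there. *)
Let zi_cont a b i : ts <= a -> {within `[a, b], continuous (fun s => z s 0 i)}.
Proof.
move=> tsa; apply: (@continuous_subspaceW _ _ _ `[ts, +oo[).
  by apply: subset_itv; rewrite ?bnd_simp.
apply: derivable_oy_Rcontinuous_within_itvcy; split.
  move=> s; rewrite in_itv/= andbT => /(@dzi _ i).
  by move=> [].
exact: (cvg_comp _ _ z_right_cont (@coord_continuous _ _ _ _ _ (z ts))).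
Qed.

(** Monotonicity gives [0 < H <= e] after [ts], hence the derivative [H ^+ 2 * f2] is at most
    [M2 * e ^+ 2] in absolute value. *)
Lemma H_drift t : ts <= t -> `|H t - e| <= M2 * e ^+ 2 * (t - ts).
Proof.
move=> tst; apply: (@MVT_le _ H (fun s => H s ^+ 2 * f2 (x s) s)) => //.
- by move=> s /itvP s_; apply: dH; rewrite (lt_trans ts_gt0) ?s_.
- by apply: (@is_derive1_within_continuous _ _ _ _ _ 0 ts_gt0) => s; exact: dH.
move=> s /itvP s_; have tss : ts <= s by rewrite s_.
have s0 : 0 <= s by rewrite (le_trans _ tss)// ltW.
rewrite normrM mulrC normrX ler_pM ?exprn_ge0 ?f2_bound//.
by rewrite lerXn2r ?nnegrE// H_abs_le.
Qed.

Lemma slow_variation s t i : ts <= s -> s <= t ->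
  `|x t 0 i - x s 0 i| <= e * M1 * (t - s).
Proof.
move=> tss st; have s0 := lt_le_trans ts_gt0 tss.
apply: (@MVT_le _ (fun u => x u 0 i) (fun u => H u * f1 (x u) u 0 i)) => //.
- by move=> u /itvP u_; apply: dxi; rewrite (lt_trans s0) ?u_.
- by apply: (@is_derive1_within_continuous _ _ _ _ _ 0 s0) => u; exact: dxi.
move=> u /itvP u_; have su : s <= u by rewrite u_.
rewrite normrM ler_pM// ?H_abs_le ?(le_trans tss)// f1_bound//.
by rewrite (le_trans (ltW s0)).
Qed.

Lemma averaged_field_bound v i : `|fbar v 0 i| <= M1.
Proof. by apply: time_average_bound => // s s_; exact/f1_bound/itv_ge0. Qed.

Lemma averaged_field_lip u v i :
  `|fbar u 0 i - fbar v 0 i| <= L * l1norm (u - v).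
Proof. by apply: time_average_dist => // s s_; exact/f1_lip/itv_ge. Qed.

Lemma averaged_variation s t i : ts <= s -> s <= t ->
  `|z t 0 i - z s 0 i| <= e * M1 * (t - s).
Proof.
move=> tss st.
apply: (@MVT_le _ (fun u => z u 0 i) (fun u => e * fbar (z u) 0 i)) => //.
- by move=> u /itvP u_; apply: dzi; rewrite (le_lt_trans tss) ?u_.
- exact: zi_cont.
move=> u /itvP u_.
by rewrite normrM (ger0_norm e_ge0) ler_wpM2l// averaged_field_bound.
Qed.

Let l1norm_variation (y : R -> 'rV[R]_n) s t :
  (forall i, `|y t 0 i - y s 0 i| <= e * M1 * (t - s)) -> t <= s + T ->
  l1norm (y t - y s) <= n%:R * (e * M1 * T).
Proof.
move=> yst st; apply: l1norm_le => i; rewrite !mxE; apply: le_trans (yst i) _.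
by rewrite ler_wpM2l ?mulr_ge0// lerBlDl.
Qed.

(** * The grid of whole periods and the one-step relations *)

Let a k := ts + k%:R * T.

Let a_ge k : ts <= a k. Proof. by rewrite lerDl mulr_ge0// ltW. Qed.

Let aS k : a k.+1 = a k + T.
Proof. by rewrite /a -natr1 mulrDl mul1r addrA. Qed.

(* Periodicity lets us shift [x] rather than the domain of integration: the
   trajectory on the k-th period is compared with the field on [ts, ts + T]. *)
Lemma slow_period_step k i :
  `|x (a k.+1) 0 i - x (a k) 0 i - e * T * fbar (x (a k)) 0 i| <=
  (M2 * e ^+ 2 * (k.+1%:R * T) * M1 + e * (L * (n%:R * (e * M1 * T)))) * T.
Proof.
have kT0 : 0 <= k%:R * T by rewrite mulr_ge0// ltW.
pose df s := H (s + k%:R * T) * f1 (x (s + k%:R * T)) s 0 i.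
have dF (s : R) : 0 < s -> is_derive s 1 (fun s => x (s + k%:R * T) 0 i) (df s).
  move=> s0; have fs := periodic_in_time_mulrn (x (s + k%:R * T)) k (ltW T_gt0)
    f1_periodic (ltW s0).
  rewrite /df -fs.
  by apply: (is_derive1_shift (f := fun u => x u 0 i)); apply: dxi; rewrite ltr_pwDl.
(* This crude bound only serves integrability; it involves [H 0] because it must also hold at times
   before [ts]. *)
have dM (s : R) : 0 < s -> `|df s| <= H 0 * M1.
  move=> s0; rewrite normrM ler_pM ?f1_bound ?(ltW s0)//.
  have s0' : 0 <= s + k%:R * T by rewrite addr_ge0 ?(ltW s0).
  by rewrite (ger0_norm (ltW (H_gt0 s0'))) H_le.
have ig : lebesgue_measure.-integrable `[ts, ts + T]
    (EFin \o (fun s => e * f1 (x (a k)) s 0 i)).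
  exact: (integrableZl _ e (f1_int (x (a k)) i)).
have ab : ts < ts + T by rewrite ltrDl.
have := derivative_near_integral ts_gt0 ab dF dM ig.
rewrite RintegralZl//; last exact: f1_int.
move=> /(_ (M2 * e ^+ 2 * (k.+1%:R * T) * M1 + e * (L * (n%:R * (e * M1 * T))))).
rewrite [ts + T - ts]addrAC subrr add0r -/(a k).
rewrite (_ : ts + T + k%:R * T = a k.+1); last by rewrite aS /a addrAC.
rewrite (_ : e * T * fbar _ 0 i =
  e * \int[lebesgue_measure]_(s in `[ts, ts + T]) f1 (x (a k)) s 0 i); last first.
  by rewrite mxE -mulrA mulVKf// gt_eqF.
apply => s s_; have tss := itv_ge s_; have s0 := itv_ge0 s_.
have sT : s <= ts + T by move: s_; rewrite in_itv/= => /andP[].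
have tsk : ts <= s + k%:R * T by rewrite (le_trans tss)// lerDl.
(* The deviation splits into the drift of [H] away from [e] and the motion of the state away from
   [x (a k)], which give the two summands of the bound. *)
rewrite (_ : df s - _ = (H (s + k%:R * T) - e) * f1 (x (s + k%:R * T)) s 0 i +
  e * (f1 (x (s + k%:R * T)) s 0 i - f1 (x (a k)) s 0 i)); last by rewrite /df; ring.
apply: le_trans (ler_normD _ _) _; rewrite !normrM (ger0_norm e_ge0) lerD//.
  rewrite ler_pM ?f1_bound//; apply: le_trans (H_drift tsk) _.
  (* As [s <= ts + T], the time elapsed since [ts] is at most [k.+1] periods. *)
  rewrite ler_wpM2l ?mulr_ge0 ?exprn_ge0//.
  by rewrite -natr1 mulrDl mul1r; lra.
rewrite ler_wpM2l//; apply: le_trans (f1_lip _ _ _ tss) _.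
rewrite ler_wpM2l//; apply: l1norm_variation => [j|].
  by apply: slow_variation; rewrite ?lerD2r.
by rewrite /a addrAC lerD2r.
Qed.

(** The averaged equation is autonomous with constant factor [e], so no integral and no drift term
    appear: the mean value bound is applied to [z] minus the linear motion with the velocity at
    [a k]. *)
Lemma averaged_period_step k i :
  `|z (a k.+1) 0 i - z (a k) 0 i - e * T * fbar (z (a k)) 0 i| <=
  e * (L * (n%:R * (e * M1 * T))) * T.
Proof.
pose c := e * fbar (z (a k)) 0 i.
have T0 : a k <= a k + T by rewrite lerDl ltW.
have := @MVT_le _ (fun s => z s 0 i - c * s) (fun s => e * fbar (z s) 0 i - c)
  (a k) (a k + T) (e * (L * (n%:R * (e * M1 * T)))) T0.
rewrite [a k + T - a k]addrAC subrr add0r aS.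
rewrite (_ : z (a k + T) 0 i - _ - _ =
  z (a k + T) 0 i - z (a k) 0 i - e * T * fbar (z (a k)) 0 i); last first.
  by rewrite /c; ring.
apply.
- move=> s /itvP s_; apply: is_deriveB.
    by apply: dzi; rewrite (le_lt_trans (a_ge k)) ?s_.
  by rewrite -[c in is_derive _ _ _ c]mulr1; exact: is_deriveZ.
- move=> s; apply: continuousB; first exact: zi_cont.
  exact: (continuous_subspaceT (@mulrl_continuous _ c)).
move=> s /itvP s_; rewrite -mulrBr normrM (ger0_norm e_ge0) ler_wpM2l//.
apply: le_trans (averaged_field_lip _ _ _) _; rewrite ler_wpM2l//.
apply: l1norm_variation => [j|]; rewrite ?s_//.
by apply: averaged_variation; rewrite ?s_.
Qed.

(** Subtracting the two one-step relations leaves a difference of averaged fields, absorbed by the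
    Lipschitz bound, and two remainders. The 2 counts one freezing error for [x] and one for [z];
    the [M2] term comes from [x] alone and grows with [k] as [H] drifts. *)
Lemma period_step k :
  l1norm (x (a k.+1) - z (a k.+1)) <=
  (1 + e * T * (n%:R * L)) * l1norm (x (a k) - z (a k)) +
  n%:R * (e ^+ 2 * T ^+ 2 * M1 * (M2 * k.+1%:R + 2 * L * n%:R)).
Proof.
rewrite mulrDl mul1r.
rewrite (_ : e * T * (n%:R * L) * _ =
  n%:R * (e * T * (L * l1norm (x (a k) - z (a k))))); last by ring.
rewrite -addrA -mulrDr.
rewrite [leLHS]/l1norm.
apply: (@le_trans _ _ (\sum_(i < n) (`|(x (a k) - z (a k)) 0 i| +
  (e * T * (L * l1norm (x (a k) - z (a k))) +
   e ^+ 2 * T ^+ 2 * M1 * (M2 * k.+1%:R + 2 * L * n%:R))))).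
  apply: ler_sum => i _; rewrite !mxE.
  rewrite (_ : x (a k.+1) 0 i - z (a k.+1) 0 i =
    (x (a k) 0 i - z (a k) 0 i) + e * T * (fbar (x (a k)) 0 i - fbar (z (a k)) 0 i) +
    ((x (a k.+1) 0 i - x (a k) 0 i - e * T * fbar (x (a k)) 0 i) -
     (z (a k.+1) 0 i - z (a k) 0 i - e * T * fbar (z (a k)) 0 i))); last by ring.
  apply: le_trans (ler_normD _ _) _; rewrite addrA lerD//.
    apply: le_trans (ler_normD _ _) _; rewrite lerD// normrM.
    rewrite ger0_norm ?mulr_ge0 ?(ltW T_gt0)//.
    by rewrite ler_wpM2l ?mulr_ge0 ?(ltW T_gt0)// averaged_field_lip.
  apply: le_trans (ler_normB _ _) _.
  apply: le_trans (lerD (slow_period_step k i) (averaged_period_step k i)) _.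
  by rewrite le_eqVlt; apply/orP; left; apply/eqP; ring.
by rewrite big_split/= sumr_const card_ord -[_ *+ n]mulr_natl.
Qed.

(** * Accumulation of the error over the periods *)

Lemma error_at_period N : l1norm (x (a N) - z (a N)) <=
  n%:R * (e ^+ 2 * M1 * (N%:R * T) * (M2 * (N%:R * T) + 2 * L * n%:R * T)) *
  expR (L * n%:R * (e * (N%:R * T))).
Proof.
have q1 : 1 <= 1 + e * T * (n%:R * L) by rewrite lerDl !mulr_ge0// ltW.
(* Every step taken has [k.+1 <= N], so the remainder with [N] in place of [k.+1] serves them
   all. *)
pose r := n%:R * (e ^+ 2 * T ^+ 2 * M1 * (M2 * N%:R + 2 * L * n%:R)).
have r0 : 0 <= r by rewrite /r !(mulr_ge0, addr_ge0, exprn_ge0)// ltW.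
have := @discrete_gronwall _ (fun k => l1norm (x (a k) - z (a k))) _ r N q1 r0.
have a0 : a 0%N = ts by rewrite /a mul0r addr0.
rewrite a0 z_ts subrr; move=> /(_ _ _)/le_trans; apply.
- by rewrite /l1norm big1// => i _; rewrite mxE normr0.
- move=> k kN; apply: le_trans (period_step k) _; rewrite lerD2l.
  rewrite ler_wpM2l// ler_wpM2l ?mulr_ge0 ?exprn_ge0 ?(ltW T_gt0)// lerD2r.
  by rewrite ler_wpM2l// ler_nat.
rewrite (_ : N%:R * r = n%:R * (e ^+ 2 * M1 * (N%:R * T) *
  (M2 * (N%:R * T) + 2 * L * n%:R * T))); last by rewrite /r; ring.
rewrite ler_wpM2l//; first by rewrite !(mulr_ge0, addr_ge0, exprn_ge0)// ltW.
(* The inequality 1 + u <= exp u, raised to the power [N], turns the growth factor into the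
   exponential. *)
rewrite (_ : L * n%:R * _ = e * T * (n%:R * L) * N%:R); last by ring.
rewrite expRM_natr lerXn2r ?nnegrE ?expR_ge0 ?(le_trans _ q1)//.
exact: expR_ge1Dx.
Qed.

Lemma averaging_error t l : ts <= t -> t <= ts + l ->
  l1norm (x t - z t) <=
  n%:R * (e ^+ 2 * M1 * l * (M2 * l + 2 * L * n%:R * T)) *
    expR (L * n%:R * (e * l)) +
  2 * (n%:R * (e * M1 * T)).
Proof.
move=> tst tl.
have tT : 0 <= (t - ts) / T by rewrite divr_ge0 ?subr_ge0// ltW.
(* [N] counts the whole periods between [ts] and [t], so [a N <= t < a N.+1]; on the incomplete
   period [x] and [z] each move by at most [n%:R * (e * M1 * T)], whence the factor 2. *)
pose N := Num.truncn ((t - ts) / T).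
have /andP[N1 N2] := truncn_itv tT; rewrite -/N in N1 N2.
rewrite ler_pdivlMr// lerBrDl -/(a N) in N1.
rewrite ltr_pdivrMr// ltrBlDl -/(a _) aS in N2.
have NTl : N%:R * T <= l by rewrite -(lerD2l ts) (le_trans N1).
have NT0 : 0 <= N%:R * T by rewrite mulr_ge0// ltW.
have xt : l1norm (x t - x (a N)) <= n%:R * (e * M1 * T).
  by apply: l1norm_variation => [i|]; [exact: slow_variation|exact: ltW].
have zt : l1norm (z t - z (a N)) <= n%:R * (e * M1 * T).
  by apply: l1norm_variation => [i|]; [exact: averaged_variation|exact: ltW].
have tri : l1norm (x t - z t) <= l1norm (x (a N) - z (a N)) +
    (l1norm (x t - x (a N)) + l1norm (z t - z (a N))).
  rewrite /l1norm -!big_split/=; apply: ler_sum => i _; rewrite !mxE.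
  rewrite (_ : x t 0 i - z t 0 i = (x (a N) 0 i - z (a N) 0 i) +
    ((x t 0 i - x (a N) 0 i) - (z t 0 i - z (a N) 0 i))); last by ring.
  by apply: le_trans (ler_normD _ _) _; rewrite lerD2l ler_normB.
apply: le_trans tri _; rewrite lerD//; last by rewrite mulr_natl mulr2n lerD.
apply: le_trans (error_at_period N) _.
have l0 := le_trans NT0 NTl.
rewrite ler_pM ?expR_ge0 ?ler_expR//.
- by rewrite !(mulr_ge0, addr_ge0, exprn_ge0)// ltW.
- rewrite ler_wpM2l// ler_pM//.
  + by rewrite !(mulr_ge0, exprn_ge0)// ltW.
  + by rewrite !(mulr_ge0, addr_ge0)// ltW.
  + by rewrite ler_wpM2l// mulr_ge0// exprn_ge0.
  + by rewrite lerD2r ler_wpM2l.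
by rewrite ler_wpM2l ?mulr_ge0// ler_wpM2l.
Qed.

End averaging.

(** * Conversion of the error bound into a power of [e] *)

(** Since [b] may exceed 1, lowering its exponent costs a power of the upper bound [B]. *)
Lemma powR_le_shift (R : realType) (b B p m : R) : 0 < b -> b <= B -> m <= p ->
  b `^ p <= B `^ (p - m) * b `^ m.
Proof.
move=> b0 bB mp; have -> : b `^ p = b `^ (p - m) * b `^ m.
  by rewrite -powRD ?subrK// (gt_eqF b0) implybT.
rewrite ler_wpM2r ?powR_ge0// ge0_ler_powR ?subr_ge0// nnegrE ltW//.
exact: lt_le_trans bB.
Qed.

Lemma error_scaling (R : realType) (n : nat) (T gamma C B L M1 M2 e : R)
    (m := Num.min 1 (2 - 2 * gamma)) (l := C * e `^ (- gamma)) :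
  0 <= T -> 0 <= gamma -> gamma <= 1 -> 0 <= C -> 0 <= L -> 0 <= M1 ->
  0 <= M2 -> 0 < e -> e <= B ->
  n%:R * (e ^+ 2 * M1 * l * (M2 * l + 2 * L * n%:R * T)) *
    expR (L * n%:R * (e * l)) + 2 * (n%:R * (e * M1 * T)) <=
  (n%:R * (M1 * (M2 * C ^+ 2 * B `^ (2 - 2 * gamma - m) +
                 2 * L * n%:R * T * C * B `^ (2 - gamma - m))) *
     expR (L * n%:R * (C * B `^ (1 - gamma))) +
   2 * (n%:R * (M1 * T * B `^ (1 - m)))) * e `^ m.
Proof.
move=> T0 g0 g1 C0 L0 M10 M20 e0 eB.
have eD p q : e `^ (p + q) = e `^ p * e `^ q.
  by rewrite powRD// (gt_eqF e0) implybT.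
have e1 : e `^ 1 = e by rewrite powRr1// ltW.
have e2 : e `^ 2 = e ^+ 2 by rewrite powR_mulrn// ltW.
(* After inserting [l], the only powers left are those with exponents 2 - 2 gamma, 2 - gamma and 1,
   besides exponent 1 - gamma inside the exponential. *)
have el : e * l = C * e `^ (1 - gamma) by rewrite /l eD e1; ring.
have e2l : e ^+ 2 * l = C * e `^ (2 - gamma) by rewrite /l eD e2; ring.
have e2l2 : e ^+ 2 * l * l = C ^+ 2 * e `^ (2 - 2 * gamma).
  have -> : 2 - 2 * gamma = 2 - gamma - gamma by ring.
  by rewrite [e `^ _]eD [e `^ (2 - _)]eD e2 /l; ring.
(* Each of these three exponents is at least [m], so each power is at most [e] to the [m] times a
   power of [B]. *)
have m1 : m <= 1 by rewrite ge_min lexx.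
have m2 : m <= 2 - 2 * gamma by rewrite ge_min lexx orbT.
have m3 : m <= 2 - gamma by apply: (le_trans m2); lra.
rewrite [leRHS]mulrDl lerD//.
  rewrite [leRHS]mulrAC ler_pM ?expR_ge0//.
  - by rewrite !(mulr_ge0, addr_ge0, exprn_ge0, powR_ge0)// ltW.
  - rewrite -[leRHS]mulrA ler_wpM2l//.
    have -> : e ^+ 2 * M1 * l * (M2 * l + 2 * L * n%:R * T) =
      M1 * (M2 * (e ^+ 2 * l * l) + 2 * L * n%:R * T * (e ^+ 2 * l)) by ring.
    rewrite e2l2 e2l -[leRHS]mulrA ler_wpM2l// [leRHS]mulrDl lerD//.
      by rewrite -!mulrA !ler_wpM2l ?exprn_ge0// powR_le_shift.
    by rewrite -!mulrA !ler_wpM2l// powR_le_shift.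
  (* Here [gamma <= 1] makes the exponent nonnegative, so the exponential is bounded uniformly in
     [e <= B]. *)
  rewrite ler_expR el ler_wpM2l ?mulr_ge0// ler_wpM2l//.
  by rewrite ge0_ler_powR ?nnegrE ?subr_ge0// ltW// (lt_le_trans e0).
rewrite -[leRHS]mulrA ler_wpM2l// -[leRHS]mulrA ler_wpM2l//.
rewrite (_ : e * M1 * T = M1 * T * e `^ 1); last by rewrite e1; ring.
by rewrite -!mulrA !ler_wpM2l// powR_le_shift.
Qed.

(** * Pointwise bounds from the suprema, and the uniform constant *)

Lemma Linfty_norm_le (R : realType) (n m : nat)
    (g : 'rV[R]_n -> R -> 'rV[R]_m) M v t :
  Linfty_norm g = M%:E -> 0 <= t -> l1norm (g v t) <= M.
Proof.
move=> gM t0; rewrite -lee_fin -gM; apply: ereal_sup_ubound.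
by exists (v, t).
Qed.

Lemma Linfty_norm_scalar_le (R : realType) (n : nat)
    (g : 'rV[R]_n -> R -> R) M v t :
  Linfty_norm_scalar g = M%:E -> 0 <= t -> `|g v t| <= M.
Proof.
move=> gM t0; rewrite -lee_fin -gM; apply: ereal_sup_ubound.
by exists (v, t).
Qed.

Theorem theorem3p1 (R : realType) (n : nat) (n_gt0 : (0 < n)%N)
    (T gamma C H0 cL M1 M2 : R) (T_gt0 : 0 < T)
    (gamma_gt0 : 0 < gamma) (gamma_lt1 : gamma < 1) (C_gt0 : 0 < C) :
  exists K : R, 0 < K /\
  forall (f1 : 'rV[R]_n -> R -> 'rV[R]_n) (f2 : 'rV[R]_n -> R -> R)
    (H : R -> R) (x : R -> 'rV[R]_n) (x0 : 'rV[R]_n)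
    (eps ts : R) (z : R -> 'rV[R]_n),
  (forall t, 0 <= t ->
     has_deriv_on_nonneg (H : R -> R^o) t (H t ^+ 2 * f2 (x t) t)) ->
  (forall t, 0 <= t -> has_deriv_on_nonneg x t (H t *: f1 (x t) t)) ->
  x 0 = x0 ->
  H 0 = H0 ->
  (forall t, 0 <= t -> 0 < H t) ->
  (forall s t, 0 <= s -> s < t -> H t < H s) ->
  H t @[t --> +oo] --> (0 : R) ->
  0 < eps -> eps < H 0 ->
  0 < ts -> eps = H ts ->
  Linfty_norm f1 = M1%:E ->
  Linfty_norm_scalar f2 = M2%:E ->
  (forall t, ts <= t -> forall u v : 'rV[R]_n,
     l1norm (f1 u t - f1 v t) <= cL * l1norm (u - v)) ->
  (forall t, ts <= t -> continuous (fun v : 'rV[R]_n => f2 v t)) ->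
  periodic_in_time T f1 ->
  periodic_in_time T f2 ->
  (* the integrals defining the average exist *)
  (forall (v : 'rV[R]_n) (i : 'I_n),
     lebesgue_measure.-integrable `[ts, ts + T] (fun s => (f1 v s 0 i)%:E)) ->
  z s @[s --> ts^'+] --> z ts ->
  (forall t, ts < t -> is_derive t 1 z (H ts *: time_average f1 ts T (z t))) ->
  z ts = x ts ->
  forall t, ts < t -> t <= ts + C * H ts `^ (- gamma) ->
    l1norm (x t - z t) <= K * H ts `^ Num.min 1 (2 - 2 * gamma).

Proof.
(* [K] is fixed before the functions are given, when the signs of [H0], [M1], [M2] and [cL] are
   still unknown; absolute values make it nonnegative in every case. *)
pose B := `|H0|.
pose m := Num.min 1 (2 - 2 * gamma).
pose K := (n%:R * (`|M1| * (`|M2| * C ^+ 2 * B `^ (2 - 2 * gamma - m) +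
                 2 * `|cL| * n%:R * T * C * B `^ (2 - gamma - m))) *
     expR (`|cL| * n%:R * (C * B `^ (1 - gamma))) +
   2 * (n%:R * (`|M1| * T * B `^ (1 - m)))).
have K_ge0 : 0 <= K.
  by rewrite !(addr_ge0, mulr_ge0, exprn_ge0, powR_ge0, expR_ge0)// ltW.
(* Adding 1 ensures strict positivity, as [K] vanishes with [M1]. *)
exists (K + 1); split; first by rewrite ltr_wpDl.
move=> f1 f2 H x x0 eps ts z dH dx _ H00 H_gt0 H_decr _ eps_gt0 eps_lt ts_gt0 epsE.
move=> f1M f2M f1L _ f1T _ f1int zr dz zts t tst tle.
have H_le s u : 0 <= s -> s <= u -> H u <= H s.
  by move=> s0; rewrite le_eqVlt => /predU1P[->//|su]; rewrite ltW// H_decr.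
have e0 : 0 < H ts by rewrite -epsE.
have eB : H ts <= B.
  by rewrite /B -H00 (le_trans _ (ler_norm _))// -epsE ltW.
(* The suprema are nonnegative because they dominate the values at state 0 and time 0. *)
have M1_ge0 : 0 <= M1.
  exact: le_trans (l1norm_ge0 _) (Linfty_norm_le 0 f1M (lexx 0)).
have M2_ge0 : 0 <= M2.
  exact: le_trans (normr_ge0 _) (Linfty_norm_scalar_le 0 f2M (lexx 0)).
have f1_bound v s i : 0 <= s -> `|f1 v s 0 i| <= M1.
  by move=> s0; apply: le_trans (coord_le_l1norm _ _) (Linfty_norm_le v f1M s0).
have f2_bound v s : 0 <= s -> `|f2 v s| <= M2.
  exact: Linfty_norm_scalar_le.
have f1_lip u v s i : ts <= s ->
    `|f1 u s 0 i - f1 v s 0 i| <= `|cL| * l1norm (u - v).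
  move=> tss; have := coord_le_l1norm (f1 u s - f1 v s) i; rewrite !mxE.
  move=> /le_trans; apply; apply: le_trans (f1L _ tss _ _) _.
  by rewrite ler_wpM2r ?l1norm_ge0// ler_norm.
have dH' (s : R) : 0 < s -> is_derive s 1 H (H s ^+ 2 * f2 (x s) s).
  by move=> s0; apply: has_deriv_on_nonneg_is_derive => //; exact/dH/ltW.
have dx' (s : R) : 0 < s -> is_derive s 1 x (H s *: f1 (x s) s).
  by move=> s0; apply: has_deriv_on_nonneg_is_derive => //; exact/dx/ltW.
apply: le_trans (averaging_error T_gt0 ts_gt0 (normr_ge0 cL) M1_ge0 M2_ge0 dH'
  dx' H_gt0 H_le f1_bound f2_bound f1_lip f1T f1int zr dz zts (ltW tst) tle) _.
apply: le_trans (error_scaling n (ltW T_gt0) (ltW gamma_gt0) (ltW gamma_lt1)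
  (ltW C_gt0) (normr_ge0 cL) M1_ge0 M2_ge0 e0 eB) _.
by rewrite ler_wpM2r ?powR_ge0// /K !(ger0_norm M1_ge0, ger0_norm M2_ge0) lerDl.
Qed.
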